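(* For every nonnegative integer $n$ and all complex numbers $m$, $w$: $$\sum_{k=0}^n \left[ (k+1)^w - k^w \right] H_k^{(m)} = (n+1)^w H_n^{(m)} - H_n^{(m-w)}.$$
   Context: For a nonnegative integer $n$ and a complex number $m$, the generalized harmonic number is $H_n^{(m)} = \sum_{k=1}^n \frac{1}{k^m}$, where $k^m = e^{m\ln k}$ with the real logarithm for positive integers $k$. In particular $H_0^{(m)} = 0$ (empty sum). The convention $0^0=1$ is used. The $k=0$ term of the sum on the left is taken to be $0$, since $H_0^{(m)}=0$, also for those $w$ for which $0^w$ is undefined. *)

(* Defs.v *)
From Stdlib Require Import Reals.
From Coquelicot Require Import Coquelicot.

Definition Cexp (z : C) : C :=
  (exp (Re z) * cos (Im z), exp (Re z) * sin (Im z))%R.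

(* [k^z = e^(z ln k)] with the real logarithm for k >= 1, and [0^0 = 1].
   For z <> 0 the value of [0^z] is set to 0: this is the usual value when
   Re z > 0, and a default where [0^z] is undefined. *)
Definition Cnpow (k : nat) (z : C) : C :=
  match k with
  | O => if Ceq_dec z (RtoC 0) then RtoC 1 else RtoC 0
  | S _ => Cexp (z * RtoC (ln (INR k)))%C
  end.

(* [sum_n_m a 1 0] is the empty sum. The monoid structure is given explicitly
   because [C] unfolds to the product [R * R]. *)
Definition harmonic (n : nat) (m : C) : C :=
  @sum_n_m C_AbelianMonoid (fun k : nat => (RtoC 1 / Cnpow k m)%C) 1 n.

(* Main.v *)
Require Import Defs.
From Stdlib Require Import Reals Lia.
From Coquelicot Require Import Coquelicot.

(** Induction on [n]: adding the term of index [n + 1] leaves the difference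
    [(n+1)^w / (n+1)^m = 1 / (n+1)^(m-w)], the last term of [H_(n+1)^(m-w)]. *)

(** This is Abel summation: shifting the difference from [k^w] to [H_k^(m)] leaves the boundary term
    [(n+1)^w H_n^(m)] minus the sum of [k^w / k^m = 1 / k^(m-w)] over [1 <= k <= n]. The exponent
    law comes from [Cexp_plus]. *)

Lemma Cexp_plus (a b : C) : Cexp (a + b) = (Cexp a * Cexp b)%C.
Proof.
  destruct a as [a1 a2], b as [b1 b2].
  unfold Cexp, Cmult, Cplus; simpl.
  rewrite exp_plus, cos_plus, sin_plus.
  f_equal; ring.
Qed.

Lemma Cexp_0 : Cexp (RtoC 0) = RtoC 1.
Proof.
  unfold Cexp, RtoC; simpl.
  rewrite exp_0, cos_0, sin_0.
  f_equal; ring.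
Qed.

(** Inverse [Cexp (- a)], by the addition law. *)
Lemma Cexp_neq_0 (a : C) : Cexp a <> RtoC 0.
Proof.
  intros Ha.
  apply C1_nz.
  transitivity (Cexp (a + - a)).
  - now rewrite Cplus_opp_r, Cexp_0.
  - rewrite Cexp_plus, Ha; apply Cmult_0_l.
Qed.

Lemma Cnpow_S_neq_0 (k : nat) (z : C) : Cnpow (S k) z <> RtoC 0.
Proof. apply Cexp_neq_0. Qed.

Lemma Cnpow_S_plus (k : nat) (a b : C) :
  Cnpow (S k) (a + b) = (Cnpow (S k) a * Cnpow (S k) b)%C.
Proof.
  unfold Cnpow.
  rewrite <- Cexp_plus.
  f_equal; ring.
Qed.

Lemma Cinv_Cnpow_S_minus (k : nat) (m w : C) :
  (RtoC 1 / Cnpow (S k) (m - w) = Cnpow (S k) w / Cnpow (S k) m)%C.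
Proof.
  replace (Cnpow (S k) m) with (Cnpow (S k) (m - w) * Cnpow (S k) w)%C.
  - field; split; apply Cnpow_S_neq_0.
  - rewrite <- Cnpow_S_plus; f_equal; ring.
Qed.

Lemma harmonic_0 (m : C) : harmonic 0 m = RtoC 0.
Proof.
  unfold harmonic.
  now rewrite sum_n_m_zero by lia.
Qed.

Lemma harmonic_S (n : nat) (m : C) :
  harmonic (S n) m = (harmonic n m + RtoC 1 / Cnpow (S n) m)%C.
Proof.
  unfold harmonic.
  now rewrite sum_n_Sm by lia.
Qed.

Theorem theorem3p1 (n : nat) (m w : C) :
  @sum_n C_AbelianMonoid
    (fun k : nat => ((Cnpow (k + 1) w - Cnpow k w) * harmonic k m)%C) n
  = (Cnpow (n + 1) w * harmonic n m - harmonic n (m - w))%C.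
Proof.
  induction n as [|n IH].
  (* The factor [H_0 = 0] cancels [0^w], whatever its default value. *)
  - rewrite sum_O, !harmonic_0.
    (* The equality is typed in the carrier of [C_AbelianMonoid]; [ring] needs it in [C]. *)
    lazymatch goal with |- ?x = ?y => change (@eq C x y) end.
    ring.
  - rewrite sum_Sn, IH, !harmonic_S, Cinv_Cnpow_S_minus.
    replace (n + 1)%nat with (S n) by lia.
    change (@plus C_AbelianMonoid) with Cplus.
    lazymatch goal with |- ?x = ?y => change (@eq C x y) end.
    field; apply Cnpow_S_neq_0.
Qed.
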